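(* Let $X,Y$ be Banach spaces, $A\in\mathcal{L}(X)$, $B\in\mathcal{L}(Y,X)$, $C\in\mathcal{L}(X,Y)$, $D\in\mathcal{L}(Y)$, and let $M=\begin{pmatrix}A&B\\ C&D\end{pmatrix}$, a bounded linear operator on $X\oplus Y$. Suppose that $A$ and $D$ have group inverses. If $A^{\pi}B=0$, $D^{\pi}C=0$, $BCA^{\pi}=0$, $ABC=0$ and $BD=BCA^{\#}B$, then $M$ has a group inverse.
   Context: $\mathcal{L}(X,Y)$ denotes the bounded linear operators from $X$ to $Y$, and $\mathcal{L}(X)=\mathcal{L}(X,X)$. In a ring $R$ with identity, $a\in R$ has a group inverse if there is $x\in R$ with $x=xax$, $ax=xa$ and $a=a^2x$; such $x$ is unique if it exists and is denoted $a^{\#}$, and then $a^{\pi}=1-aa^{\#}$. These notions are applied in the rings $\mathcal{L}(X)$, $\mathcal{L}(Y)$ and $\mathcal{L}(X\oplus Y)$. *)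

(* Defs.v *)
From HB Require Import structures.
From mathcomp Require Import all_boot all_order all_algebra.
From mathcomp Require Import boolp classical_sets topology prodnormedzmodule.
From mathcomp Require Import normedtype.

Set Implicit Arguments.
Unset Strict Implicit.
Unset Printing Implicit Defensive.

Import Order.TTheory GRing.Theory Num.Theory.
Import numFieldNormedType.Exports.
Local Open Scope ring_scope.

(* [pzRingType] (and not [nzRingType]) because L(X) is the zero ring when
   X is the zero space. *)
Section GroupInverse.
Variable R : pzRingType.
Implicit Types a x y : R.

Definition is_group_inverse a x : Prop :=
  [/\ x = x * a * x, a * x = x * a & a = a ^+ 2 * x].

Definition has_group_inverse a : Prop := exists x, is_group_inverse a x.

(* Total functions: both are meaningful only under [has_group_inverse a]. *)
Definition group_inv a : R := xget 0 [set x | is_group_inverse a x]%classic.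
Definition spectral_idem a : R := 1 - a * group_inv a.

Lemma is_group_inverse_uniq a x y :
  is_group_inverse a x -> is_group_inverse a y -> x = y.
Proof.
move=> [x1 x2 x3] [y1 y2 y3].
have ax : a * x * a = a by rewrite -mulrA -x2 mulrA -expr2 -x3.
have ay : a * y * a = a by rewrite -mulrA -y2 mulrA -expr2 -y3.
have e : a * x = a * y.
  by rewrite -[in LHS]ay -mulrA x2 y2 -mulrA [a * (x * a)]mulrA ax.
transitivity (x * (a * y)); first by rewrite -e mulrA.
by rewrite mulrA -x2 e y2 -y1.
Qed.

Lemma group_invP a : has_group_inverse a -> is_group_inverse a (group_inv a).
Proof. exact: xgetPex. Qed.

Lemma group_inv_eq a x : is_group_inverse a x -> group_inv a = x.
Proof.
move=> ax; apply: (is_group_inverse_uniq _ ax).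
by apply: group_invP; exists x.
Qed.

End GroupInverse.

Notation "a ^#g" := (group_inv a) (at level 2, format "a ^#g") : ring_scope.
Notation "a ^pi" := (spectral_idem a) (at level 2, format "a ^pi") : ring_scope.

Section BoundedOperators.
Variable K : numFieldType.

(* [0 <= M] is not automatic when X is the zero space, and [K] need not be
   totally ordered. *)
Definition bounded_op (X Y : normedModType K) (f : X -> Y) : Prop :=
  exists2 M : K, 0 <= M & forall x, `|f x| <= M * `|x|.

Record bop (X Y : normedModType K) := BOp {
  bop_fun :> X -> Y;
  bop_linear : linear bop_fun;
  bop_bounded : bounded_op bop_fun }.

HB.instance Definition _ (X Y : normedModType K) := gen_eqMixin (bop X Y).
HB.instance Definition _ (X Y : normedModType K) := gen_choiceMixin (bop X Y).

HB.instance Definition _ (X Y : normedModType K) (f : bop X Y) :=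
  GRing.isLinear.Build K X Y *:%R (bop_fun f) (bop_linear f).

Lemma bopP (X Y : normedModType K) (f g : bop X Y) :
  (forall x, f x = g x) -> f = g.
Proof.
case: f g => [f fl fb] [g gl gb] /= /funext fg.
by subst g; congr BOp; exact: Prop_irrelevance.
Qed.

Lemma bop_continuous (X Y : normedModType K) (f : bop X Y) : continuous f.
Proof.
apply/linear_bounded_continuous/linear_boundedP.
have [M M0 fM] := bop_bounded f.
exists M; split; first exact: ger0_real.
by move=> r /ltW Mr x; apply: le_trans (fM x) _; rewrite ler_wpM2r.
Qed.

Section Group.
Variables X Y : normedModType K.
Implicit Types f g h : bop X Y.

Let zero_linear : linear (fun _ : X => 0 : Y).
Proof. by move=> a x y; rewrite scaler0 addr0. Qed.
Let zero_bounded : bounded_op (fun _ : X => 0 : Y).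
Proof. by exists 0 => // x; rewrite normr0 mul0r. Qed.
Definition bop_zero := BOp zero_linear zero_bounded.

Let add_linear f g : linear (fun x => f x + g x).
Proof. by move=> a x y; rewrite !linearP scalerDr addrACA. Qed.
Let add_bounded f g : bounded_op (fun x => f x + g x).
Proof.
have [M M0 fM] := bop_bounded f; have [N N0 gN] := bop_bounded g.
exists (M + N) => [|x]; first exact: addr_ge0.
by rewrite mulrDl; apply: le_trans (ler_normD _ _) (lerD _ _).
Qed.
Definition bop_add f g := BOp (add_linear f g) (add_bounded f g).

Let opp_linear f : linear (fun x => - f x).
Proof. by move=> a x y; rewrite linearP opprD scalerN. Qed.
Let opp_bounded f : bounded_op (fun x => - f x).
Proof. by have [M M0 fM] := bop_bounded f; exists M => // x; rewrite normrN. Qed.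
Definition bop_opp f := BOp (opp_linear f) (opp_bounded f).

Let addA : associative bop_add.
Proof. by move=> f g h; apply: bopP => x /=; rewrite addrA. Qed.
Let addC : commutative bop_add.
Proof. by move=> f g; apply: bopP => x /=; rewrite addrC. Qed.
Let add0 : left_id bop_zero bop_add.
Proof. by move=> f; apply: bopP => x /=; rewrite add0r. Qed.
Let addN : left_inverse bop_zero bop_opp bop_add.
Proof. by move=> f; apply: bopP => x /=; rewrite addNr. Qed.

HB.instance Definition _ := GRing.isZmodule.Build (bop X Y) addA addC add0 addN.

Lemma bop0E x : (0 : bop X Y) x = 0. Proof. by []. Qed.
Lemma bopDE f g x : (f + g) x = f x + g x. Proof. by []. Qed.
Lemma bopNE f x : (- f) x = - f x. Proof. by []. Qed.

End Group.

Section Composition.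
Variables X Y Z : normedModType K.

Let comp_linear (f : bop Y Z) (g : bop X Y) : linear (fun x => f (g x)).
Proof. by move=> a x y; rewrite !linearP. Qed.
Let comp_bounded (f : bop Y Z) (g : bop X Y) : bounded_op (fun x => f (g x)).
Proof.
have [M M0 fM] := bop_bounded f; have [N N0 gN] := bop_bounded g.
exists (M * N) => [|x]; first exact: mulr_ge0.
by apply: le_trans (fM _) _; rewrite -mulrA ler_wpM2l.
Qed.
Definition bop_comp (f : bop Y Z) (g : bop X Y) : bop X Z :=
  BOp (comp_linear f g) (comp_bounded f g).

End Composition.

Section Ring.
Variable X : normedModType K.
Implicit Types f g h : bop X X.

Let id_linear : linear (fun x : X => x).
Proof. by []. Qed.
Let id_bounded : bounded_op (fun x : X => x).
Proof. by exists 1 => // x; rewrite mul1r. Qed.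
Definition bop_id := BOp id_linear id_bounded.

Let mulA : associative (@bop_comp X X X).
Proof. by move=> f g h; apply: bopP. Qed.
Let mul1 : left_id bop_id (@bop_comp X X X).
Proof. by move=> f; apply: bopP. Qed.
Let mulf1 : right_id bop_id (@bop_comp X X X).
Proof. by move=> f; apply: bopP. Qed.
Let mulDl : left_distributive (@bop_comp X X X) +%R.
Proof. by move=> f g h; apply: bopP. Qed.
Let mulDr : right_distributive (@bop_comp X X X) +%R.
Proof. by move=> f g h; apply: bopP => x /=; rewrite raddfD. Qed.

HB.instance Definition _ :=
  GRing.Zmodule_isPzRing.Build (bop X X) mulA mul1 mulf1 mulDl mulDr.

Lemma bop1E x : (1 : bop X X) x = x. Proof. by []. Qed.
Lemma bopME f g x : (f * g) x = f (g x). Proof. by []. Qed.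
Lemma bop_mulE f g : f * g = bop_comp f g. Proof. by []. Qed.

End Ring.

(* The library norms [X * Y] by the maximum of the two norms, which is
   equivalent to the other usual norms on the direct sum. *)
Section Block.
Variables X Y : normedModType K.
Variables (A : bop X X) (B : bop Y X) (C : bop X Y) (D : bop Y Y).

Let block_fun (z : X * Y) : X * Y := (A z.1 + B z.2, C z.1 + D z.2).

Let block_linear : linear block_fun.
Proof.
move=> a [x y] [x' y']; apply: injective_projections => /=;
  by rewrite !linearP scalerDr addrACA.
Qed.

Let block_bounded : bounded_op block_fun.
Proof.
have [a a0 Aa] := bop_bounded A; have [b b0 Bb] := bop_bounded B.
have [c c0 Cc] := bop_bounded C; have [d d0 Dd] := bop_bounded D.
exists (a + b + (c + d)) => [|z]; first by rewrite !addr_ge0.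
have xz : `|z.1| <= `|z| by rewrite prod_normE /= comparable_le_max
  ?lexx // real_comparable ?normr_real.
have yz : `|z.2| <= `|z| by rewrite prod_normE /= comparable_le_max
  ?lexx ?orbT // real_comparable ?normr_real.
have H (V : normedModType K) (u v : V) (p q : K) : 0 <= p -> 0 <= q ->
    `|u| <= p * `|z.1| -> `|v| <= q * `|z.2| -> `|u + v| <= (p + q) * `|z|.
  move=> p0 q0 up vq; rewrite mulrDl; apply: le_trans (ler_normD _ _) (lerD _ _).
    by apply: le_trans up _; rewrite ler_wpM2l.
  by apply: le_trans vq _; rewrite ler_wpM2l.
rewrite [X in X <= _]prod_normE /= comparable_ge_max.
  apply/andP; split.
    apply: le_trans (H _ _ _ _ _ a0 b0 (Aa z.1) (Bb z.2)) _.
    by rewrite ler_wpM2r // lerDl addr_ge0.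
  apply: le_trans (H _ _ _ _ _ c0 d0 (Cc z.1) (Dd z.2)) _.
  by rewrite ler_wpM2r // lerDr addr_ge0.
by rewrite real_comparable ?normr_real.
Qed.

Definition bop_block : bop (X * Y)%type (X * Y)%type :=
  BOp block_linear block_bounded.

Lemma bop_blockE x y : bop_block (x, y) = (A x + B y, C x + D y).
Proof. by []. Qed.

End Block.

End BoundedOperators.

Notation "''L' ( X , Y )" := (bop X Y)
  (at level 8, format "''L' ( X ,  Y )") : type_scope.
(* Products between different spaces; on a single space, [A ** B] is
   convertible to the ring product [A * B], see [bop_mulE]. *)
Notation "A ** B" := (bop_comp A B) (at level 40, left associativity) : ring_scope.

(* Main.v *)
(* Since A A# B = B and A commutes with A#, ABC = 0 forces BC = 0, whence BD = 0.
   So M = P + Q with P = (A B; 0 0) and Q = (0 0; C D), where PQ = (BC BD; 0 0) = 0.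
   Both rows are group invertible, P# = (A# A#A#B; 0 0) and Q# = (0 0; D#D#C D#),
   and when PQ = 0 the sum P + Q has the group inverse Q^pi P# + Q# P^pi. *)
Require Import Defs.
From HB Require Import structures.
From mathcomp Require Import all_boot all_order all_algebra.
From mathcomp Require Import boolp classical_sets topology prodnormedzmodule.
From mathcomp Require Import normedtype.

Set Implicit Arguments.
Unset Strict Implicit.
Unset Printing Implicit Defensive.

Import Order.TTheory GRing.Theory Num.Theory.
Import numFieldNormedType.Exports.
Local Open Scope ring_scope.

Section GroupInverseSum.
Variable R : pzRingType.
Implicit Types a b x y p q : R.

Lemma is_group_inverse_mulK a x : is_group_inverse a x -> a * x * a = a.
Proof. by move=> [_ ax aax]; rewrite -mulrA -ax mulrA -expr2 -aax. Qed.

(** When $a$ and $x$ commute, $a^2x = axa$, so $a = a^2x$ may be replaced by $axa = a$, which is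
    easier to check for sums and blocks. *)
Lemma is_group_inverseI a x :
  a * x = x * a -> a * x * a = a -> x * a * x = x -> is_group_inverse a x.
Proof. by move=> ax axa xax; split=> //; rewrite expr2 -mulrA ax mulrA axa. Qed.

(** From $y = qy^2$ and $x = x^2p$, the assumption $pq = 0$ gives $py = 0$ and $xq = 0$. Hence both
    products of $p + q$ with the candidate $z$ equal $e = px + qy(1 - px)$, and it remains to see
    that $e$ fixes $p + q$ and $z$ from the left. *)
Lemma is_group_inverse_add p q x y :
    is_group_inverse p x -> is_group_inverse q y -> p * q = 0 ->
  is_group_inverse (p + q) ((1 - q * y) * x + y * (1 - p * x)).
Proof.
move=> px qy pq0.
have pxp := is_group_inverse_mulK px; have qyq := is_group_inverse_mulK qy.
have [xE pxC _] := px; have [yE qyC _] := qy.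
have py0 : p * y = 0 by rewrite yE -qyC !mulrA pq0 !mul0r.
have xq0 : x * q = 0 by rewrite xE -(mulrA x) pxC -!mulrA pq0 !mulr0.
have qqy : q * (q * y) = q by rewrite qyC mulrA.
set z := (_ * x + _).
have pz : p * z = p * x.
  by rewrite mulrDr !mulrA py0 mul0r addr0 mulrBr mulr1 mulrA pq0 mul0r subr0.
have qz : q * z = q * y * (1 - p * x).
  by rewrite mulrDr !mulrA mulrBr mulr1 qqy subrr mul0r add0r.
have zp : z * p = (1 - q * y) * (p * x).
  by rewrite mulrDl -!mulrA [(1 - p * x) * p]mulrBl mul1r pxp subrr mulr0 addr0
    pxC.
have zq : z * q = q * y.
  by rewrite mulrDl -!mulrA xq0 mulr0 add0r mulrBl mul1r -mulrA xq0 mulr0 subr0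
    qyC.
have pxz : p * x * z = x by rewrite pxC -mulrA pz mulrA -xE.
have qyz : q * y * z = y * (1 - p * x).
  by rewrite qyC -mulrA qz mulrA [y * (q * y)]mulrA -yE.
have pqz : (p + q) * z = p * x + q * y * (1 - p * x) by rewrite mulrDl pz qz.
have zpq : z * (p + q) = p * x + q * y * (1 - p * x).
  by rewrite mulrDr zp zq mulrBl mulrBr mul1r mulr1 addrAC addrA.
apply: is_group_inverseI; rewrite ?zpq ?pqz //.
(* From the left, $1 - px$ kills $p$ and fixes $q$, so $e(p + q) = pxp + pxq + qyq = p + q$. *)
- have pxNp : (1 - p * x) * p = 0 by rewrite mulrBl mul1r pxp subrr.
  have pxNq : (1 - p * x) * q = q.
    by rewrite mulrBl mul1r -mulrA xq0 mulr0 subr0.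
  rewrite mulrDl -[q * y * _ * _]mulrA !mulrDr pxNp pxNq pxp qyq mulr0 add0r.
  by rewrite -mulrA xq0 mulr0 addr0.
(* Here $ez = pxz + qyz - qy(pxz) = x + y(1 - px) - qyx = z$. *)
- by rewrite mulrDl mulrBr mulr1 mulrBl -[_ * (p * x) * z]mulrA pxz qyz /z
    mulrBl mul1r addrA addrAC.
Qed.

End GroupInverseSum.

Section BlockOperators.
Variable K : numFieldType.

Section Composition.
Variables X Y Z : normedModType K.

(** The ring laws cover a single space only; these rules serve composition between different
    spaces. *)
Lemma bop_compA (W : normedModType K) (f : 'L(Z, W)) (g : 'L(Y, Z))
  (h : 'L(X, Y)) : f ** (g ** h) = f ** g ** h.
Proof. exact: bopP. Qed.

Lemma bop_comp1l (f : 'L(X, Y)) : 1 ** f = f.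
Proof. exact: bopP. Qed.

Lemma bop_comp0l (f : 'L(X, Y)) : (0 : 'L(Y, Z)) ** f = 0.
Proof. exact: bopP. Qed.

Lemma bop_comp0r (f : 'L(Y, Z)) : f ** (0 : 'L(X, Y)) = 0.
Proof. by apply: bopP => x; exact: raddf0. Qed.

Lemma bop_compBl (f g : 'L(Y, Z)) (h : 'L(X, Y)) :
  (f - g) ** h = f ** h - g ** h.
Proof. exact: bopP. Qed.

End Composition.

Variables X Y : normedModType K.
Implicit Types (A : 'L(X, X)) (B : 'L(Y, X)) (C : 'L(X, Y)) (D : 'L(Y, Y)).

Lemma bop_block_mul A B C D A' B' C' D' :
  bop_block A B C D * bop_block A' B' C' D' =
  bop_block (A ** A' + B ** C') (A ** B' + B ** D')
            (C ** A' + D ** C') (C ** B' + D ** D').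
Proof.
apply: bopP => -[x y]; rewrite bopME !bop_blockE.
by apply: injective_projections => /=; rewrite !raddfD addrACA.
Qed.

Lemma bop_block_add A B C D A' B' C' D' :
  bop_block A B C D + bop_block A' B' C' D' =
  bop_block (A + A') (B + B') (C + C') (D + D').
Proof.
apply: bopP => -[x y]; rewrite bopDE !bop_blockE.
by apply: injective_projections => /=; rewrite addrACA.
Qed.

Lemma bop_block0 : bop_block (0 : 'L(X, X)) 0 0 (0 : 'L(Y, Y)) = 0.
Proof. by apply: bopP => -[x y]; rewrite bop_blockE /= !addr0. Qed.

(** The domain [Z] is arbitrary so that this applies to the pair $A, B$ as well as to $D, C$. *)
Lemma spectral_idem_comp_eq0 (Z : normedModType K) (A : 'L(X, X))
  (B : 'L(Z, X)) : A^pi ** B = 0 -> A ** A^#g ** B = B.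
Proof.
rewrite /spectral_idem bop_compBl bop_comp1l => /eqP.
by rewrite subr_eq0 => /eqP {2}->.
Qed.

(** Both products of the row with its candidate equal $(AA'\ A'B; 0\ 0)$, and $AA'$ fixes $A$ and
    $B$ from the left. *)
Lemma is_group_inverse_upper_row A B A' :
    is_group_inverse A A' -> A ** A' ** B = B ->
  is_group_inverse (bop_block A B 0 (0 : 'L(Y, Y)))
    (bop_block A' (A' ** A' ** B) 0 0).
Proof.
move=> AA' AA'B.
have AA'A := is_group_inverse_mulK AA'; have [A'E AA'C _] := AA'.
move: AA'A A'E AA'C; rewrite !bop_mulE => AA'A A'E AA'C.
have AA'A'B : A ** (A' ** A' ** B) = A' ** B.
  by rewrite !bop_compA AA'C -A'E.
apply: is_group_inverseI; rewrite !bop_block_mul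
  !(bop_comp0l, bop_comp0r, addr0); congr bop_block => //.
(* What is left is the upper right entry $A'AA'A'B = A'A'B$. *)
by rewrite !bop_compA -A'E.
Qed.

(** Mirror case: both products are $(0\ 0; D'C\ DD')$. *)
Lemma is_group_inverse_lower_row C D D' :
    is_group_inverse D D' -> D ** D' ** C = C ->
  is_group_inverse (bop_block (0 : 'L(X, X)) 0 C D)
    (bop_block 0 0 (D' ** D' ** C) D').
Proof.
move=> DD' DD'C.
have DD'D := is_group_inverse_mulK DD'; have [D'E DD'K _] := DD'.
move: DD'D D'E DD'K; rewrite !bop_mulE => DD'D D'E DD'K.
have DD'D'C : D ** (D' ** D' ** C) = D' ** C.
  by rewrite !bop_compA DD'K -D'E.
apply: is_group_inverseI; rewrite !bop_block_mul
  !(bop_comp0l, bop_comp0r, add0r); congr bop_block => //.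
by rewrite !bop_compA -D'E.
Qed.

End BlockOperators.

Theorem theorem4p5 (K : numFieldType) (X Y : completeNormedModType K)
  (A : 'L(X, X)) (B : 'L(Y, X)) (C : 'L(X, Y)) (D : 'L(Y, Y))
  (hA : has_group_inverse A) (hD : has_group_inverse D)
  (hAB : A^pi ** B = 0)
  (hDC : D^pi ** C = 0)
  (hBCA : B ** C ** A^pi = 0)
  (hABC : A ** B ** C = 0)
  (hBD : B ** D = B ** C ** A^#g ** B) :
  has_group_inverse (bop_block A B C D).
Proof.
have AiA := group_invP hA; have DiD := group_invP hD.
have AAB := spectral_idem_comp_eq0 hAB.
have DDC := spectral_idem_comp_eq0 hDC.
have BC0 : B ** C = 0.
  have [_ AC _] := AiA.
  (* Commutation is available for the ring product, hence the passage from [**] to [*] and back;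
     then $BC = A^{\#}(ABC)$. *)
  rewrite -AAB -[A ** A^#g]/(A * A^#g) AC -[A^#g * A]/(A^#g ** A).
  by rewrite -!bop_compA [A ** (B ** C)]bop_compA hABC bop_comp0r.
have BD0 : B ** D = 0 by rewrite hBD BC0 !bop_comp0l.
have -> : bop_block A B C D = bop_block A B 0 0 + bop_block 0 0 C D.
  by rewrite bop_block_add !addr0 !add0r.
(* The witness is fixed by the two row inverses supplied next. *)
eexists; apply: is_group_inverse_add.
- exact: is_group_inverse_upper_row AiA AAB.
- exact: is_group_inverse_lower_row DiD DDC.
- rewrite bop_block_mul !(bop_comp0l, bop_comp0r, addr0) !add0r BC0 BD0.
  exact: bop_block0.
Qed.
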